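(* Let $X_1,\dots,X_n$ be i.i.d. real random variables with well-defined mean $\mu$ and variance $\sigma^2<+\infty$. Let $0<x\leq \sqrt{n/(\sqrt{2}+1)^2-2}$ and set $k(x):=\lceil x^2/2\rceil$. Then \[\Pr\left(|\overline{X}_{n,k(x)}-\mu|>\frac{(3\sqrt{2}+8+(4+4\sqrt{2})\,x)\,\sigma}{\sqrt{n}}\right)\leq 4\exp\left(-\frac{x^2}{2}\right).\]
   Context: For $X_{(1)}\leq\dots\leq X_{(n)}$ the order statistics of the sample and an integer $0\le k<n/2$, the $k$-trimmed mean is $\overline{X}_{n,k}:=\frac{1}{n-2k}\sum_{i=k+1}^{n-k}X_{(i)}$. *)

(* Defs.v *)
From HB Require Import structures.
From mathcomp Require Import all_boot all_order all_algebra.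
From mathcomp Require Import all_classical all_reals all_analysis.
Set Implicit Arguments. Unset Strict Implicit. Unset Printing Implicit Defensive.
Import Order.TTheory GRing.Theory Num.Theory.
Local Open Scope classical_set_scope.
Local Open Scope ring_scope.

(* Mutual independence of a finite family of real random variables:
   the product rule for preimages of arbitrary Borel sets (taking
   B i = setT recovers every subfamily). *)
Definition mutually_independent d (T : measurableType d) (R : realType)
  (P : probability T R) (n : nat) (X : 'I_n -> {RV P >-> R}) : Prop :=
  forall B : 'I_n -> set R, (forall i, measurable (B i)) ->
    P (\bigcap_(i in [set: 'I_n]) (X i @^-1` B i)) =
    (\prod_(i < n) P (X i @^-1` B i))%E.

Definition identically_distributed d (T : measurableType d) (R : realType)
  (P : probability T R) (n : nat) (X : 'I_n -> {RV P >-> R}) : Prop :=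
  forall (i j : 'I_n) (A : set R), measurable A ->
    distribution P (X i) A = distribution P (X j) A.

(* order statistics of a sample: s`_0 <= ... <= s`_(n-1);
   X_(i) (1-indexed, as in the paper) is (order_stats x)`_(i-1) *)
Definition order_stats (R : realType) (n : nat) (x : 'I_n -> R) : seq R :=
  sort <=%R [seq x i | i <- enum 'I_n].

Definition trimmed_mean (R : realType) (n k : nat) (x : 'I_n -> R) : R :=
  (\sum_(k <= i < n - k) (order_stats x)`_i) / (n - 2 * k)%:R.
Arguments trimmed_mean {R} n k x.

(* Main.v *)
Require Import Defs.
From HB Require Import structures.
From mathcomp Require Import all_boot all_order all_algebra.
From mathcomp Require Import all_classical all_reals all_analysis.
From mathcomp Require Import measurable_realfun ring lra zify.
(** Put [M = 3 sigma sqrt (n / k)].  Exponential moment bounds, using only the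
    variance, show that each of the following events has probability at most
    [exp (- k)]: more than [k] observations exceed [mu + M]; more than [k] lie
    below [mu - M]; the sum of the deviations [X_i - mu] clipped at [+-M] exceeds
    [11 / 9 * k * M]; it is below [- 11 / 9 * k * M].  Outside these events every
    order statistic kept by the trimming is within [M] of [mu], so its deviation
    is its clipped deviation; the [2 k] discarded terms change the clipped sum by
    at most [2 k M], whence [|trimmed mean - mu| <= 29 / 9 * k M / (n - 2 k)].
    For [sigma = 0] the argument works for every [M > 0], and one lets [M] tend
    to [0]. *)
Set Implicit Arguments. Unset Strict Implicit. Unset Printing Implicit Defensive.
Import Order.TTheory GRing.Theory Num.Theory.
Import numFieldNormedType.Exports HBNNSimple.
Local Open Scope classical_set_scope.
Local Open Scope ring_scope.

(** * Integrals of a weight times a function of a random variable *)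

Lemma cvg_integral_weighted_approx d d' (T : measurableType d)
    (T' : measurableType d') (R : realType)
    (m : {measure set T -> \bar R}) (Y : T -> T') (W : T -> R) (h : T' -> R)
    (mh : measurable_fun setT (EFin \o h)) :
  measurable_fun setT Y -> measurable_fun setT W ->
  (forall t, 0 <= W t) -> (forall y, 0 <= h y) ->
  (\int[m]_t (W t * nnsfun_approx measurableT mh n (Y t))%:E)%E
    @[n --> \oo] --> (\int[m]_t (W t * h (Y t))%:E)%E.
Proof.
move=> mY mW W0 h0.
pose g n t := (W t * nnsfun_approx measurableT mh n (Y t))%:E.
have lim_g t : limn (g ^~ t) = (W t * h (Y t))%:E.
  apply/cvg_lim => //; rewrite /g EFinM.
  under eq_fun do rewrite EFinM.
  apply: cvgeZl => //.
  by apply: (cvg_nnsfun_approx measurableT mh) => // y _; rewrite /= lee_fin.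
under eq_integral => t _ do rewrite -lim_g.
apply: (cvg_monotone_convergence measurableT).
- move=> n; apply/measurable_EFinP; apply: measurable_funM => //.
  by apply: measurableT_comp => //; exact: measurable_funP.
- by move=> n t _; rewrite lee_fin mulr_ge0.
- move=> t _ p q pq; rewrite lee_fin ler_wpM2l//.
  exact/lefP/nd_nnsfun_approx.
Qed.

Lemma integral_weighted_nnsfun d d' (T : measurableType d)
    (T' : measurableType d') (R : realType)
    (m : {measure set T -> \bar R}) (Y : T -> T') (W : T -> R)
    (g : {nnsfun T' >-> R}) :
  measurable_fun setT Y -> measurable_fun setT W -> (forall t, 0 <= W t) ->
  (\int[m]_t (W t * g (Y t))%:E =
   \sum_(y \in range g) y%:E * \int[m]_t (W t * \1_(g @^-1` [set y]) (Y t))%:E)%E.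
Proof.
move=> mY mW W0.
have ran0 y : range g y -> 0 <= y by move=> [t _ <-].
transitivity (\int[m]_t (\sum_(y \in range g)
    (y%:E * (W t * \1_(g @^-1` [set y]) (Y t))%:E))%E)%E.
  apply: eq_integral => t _; rewrite fimfunE.
  rewrite !fsbig_finite// mulr_sumr -sumEFin; apply: eq_bigr => y _.
  by rewrite -EFinM mulrCA.
have mI y : measurable_fun setT
    (fun t => (W t * \1_(g @^-1` [set y]) (Y t))%:E).
  apply/measurable_EFinP; apply: measurable_funM => //.
  apply: measurableT_comp => //; exact: measurable_indic.
(* [ge0_integral_fsum] asks for nonnegative terms at every [y], on the range of [g] or not; hence
   [Num.max 0 y], which is [y] on the range. *)
transitivity (\sum_(y \in range g)
    (\int[m]_t ((Num.max 0 y)%:E * (W t * \1_(g @^-1` [set y]) (Y t))%:E)))%E.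
  rewrite -ge0_integral_fsum//.
  - apply: eq_integral => t _; apply: eq_fsbigr => y; rewrite inE => /ran0 y0.
    by rewrite max_r.
  - by move=> y; exact: measurable_funeM.
  - by move=> y t _; rewrite mule_ge0// lee_fin ?mulr_ge0// le_max lexx.
apply: eq_fsbigr => y; rewrite inE => /ran0 y0.
rewrite max_r// ge0_integralZl_EFin// => t _.
by rewrite lee_fin mulr_ge0.
Qed.

(** The usual extension from indicators to simple functions to monotone limits. Below, [W] is the
    product of all factors but one, and [c] the product of their expectations. *)
Lemma integral_weighted_comp d d' (T : measurableType d)
    (T' : measurableType d') (R : realType)
    (m : {measure set T -> \bar R}) (Y : T -> T') (W : T -> R) (c : R) :
  measurable_fun setT Y -> measurable_fun setT W ->
  (forall t, 0 <= W t) -> 0 <= c ->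
  (forall B, measurable B -> (\int[m]_t (W t * \1_B (Y t))%:E =
     c%:E * \int[m]_t (\1_B (Y t))%:E)%E) ->
  forall h : T' -> R, measurable_fun setT h -> (forall y, 0 <= h y) ->
  (\int[m]_t (W t * h (Y t))%:E = c%:E * \int[m]_t (h (Y t))%:E)%E.
Proof.
move=> mY mW W0 c0 WB h mh h0.
have mhE : measurable_fun setT (EFin \o h) by exact/measurable_EFinP.
have m1 : measurable_fun setT (cst 1 : T -> R) by [].
have c1 := @cvg_integral_weighted_approx _ _ _ _ _ m _ _ _ mhE mY mW W0 h0.
(* Weight 1 puts the right-hand side in the same form; the two limits agree because the approximants
   do. *)
have c2 := @cvg_integral_weighted_approx _ _ _ _ _ m _ _ _ mhE mY m1 (fun=> ler01) h0.
have {}c2 := cvgeZl (isT : c%:E \is a fin_num) c2.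
under [in RHS]eq_integral do rewrite -[h _]mul1r.
apply: (cvg_unique _ c1); first exact: ereal_hausdorff.
apply: cvg_trans c2; apply: near_eq_cvg; apply: nearW => n.
rewrite !integral_weighted_nnsfun// !fsbig_finite// big_seq [RHS]big_seq ge0_sume_distrr.
  apply: eq_bigr => y _; rewrite WB; last by [].
  by rewrite muleCA; under [in LHS]eq_integral do rewrite mul1r.
move=> y; rewrite in_fset_set// inE => -[t _ <-].
rewrite mule_ge0 ?lee_fin//; apply: integral_ge0 => u _.
by rewrite lee_fin mulr_ge0.
Qed.

(** * Product rule for expectations under independence *)

Section expectation_of_product.
Context d (T : measurableType d) (R : realType) (P : probability T R).
Context (n : nat) (X : 'I_n -> {RV P >-> R}).
Hypothesis indepX : mutually_independent X.

Let measurable_preimage i (B : set R) : measurable B -> measurable (X i @^-1` B).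
Proof. by move=> mB; rewrite -[_ @^-1` _]setTI; exact: measurable_funP. Qed.

Let integral_indic_comp i (B : set R) : measurable B ->
  (\int[P]_t (\1_B (X i t))%:E = P (X i @^-1` B))%E.
Proof.
move=> mB; transitivity (\int[P]_t (\1_(X i @^-1` B) t)%:E)%E.
  by apply: eq_integral.
by rewrite integral_indic ?setIT//; exact: measurable_preimage.
Qed.

(** The product of the indicators is the indicator of the intersection, to which the product rule
    for events applies. *)
Let integral_prod_indic (B : 'I_n -> set R) : (forall i, measurable (B i)) ->
  (\int[P]_t (\prod_i \1_(B i) (X i t))%:E =
   \prod_i \int[P]_t (\1_(B i) (X i t))%:E)%E.
Proof.
move=> mB.
have mXB i : measurable (X i @^-1` B i) by exact: measurable_preimage.
transitivity (P (\bigcap_(i in [set: 'I_n]) (X i @^-1` B i))).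
  transitivity (\int[P]_t (\1_(\bigcap_(i in [set: 'I_n]) (X i @^-1` B i)) t)%:E)%E.
    apply: eq_integral => t _; congr EFin; rewrite [RHS]indicE.
    have [tB|tB] := boolP (t \in _).
      rewrite big1// => i _; rewrite indicE mem_set//.
      by move: tB; rewrite inE => /(_ i I).
    apply/eqP/prodf_eq0; move: tB; rewrite notin_setE.
    move=> /existsNP[i /not_implyP[_ /= tB]]; exists i => //.
    by rewrite indicE memNset.
  rewrite integral_indic// ?setIT//.
  by apply: fin_bigcap_measurable.
by rewrite indepX//; apply: eq_bigr => i _; rewrite integral_indic_comp.
Qed.

(* The functions [h i] are freed one index at a time: only those with [i < m]
   are arbitrary, the others are indicators. *)
Let integral_prod_comp_upto (m : nat) (h : 'I_n -> R -> R) :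
  (forall i, measurable_fun setT (h i)) -> (forall i y, 0 <= h i y) ->
  (forall i, (\int[P]_t (h i (X i t))%:E)%E \is a fin_num) ->
  (forall i : 'I_n, (m <= i)%N -> exists2 B, measurable B & h i = \1_B) ->
  (\int[P]_t (\prod_i h i (X i t))%:E = \prod_i \int[P]_t (h i (X i t))%:E)%E.
Proof.
elim: m h => [|m IHm] h mh h0 hfin hB.
  have /choice[B hBE] : forall i, exists B, measurable B /\ h i = \1_B.
    by move=> i; have [B mB hiE] := hB i isT; exists B.
  transitivity (\int[P]_t (\prod_i \1_(B i) (X i t))%:E)%E.
    apply: eq_integral => t _; congr EFin; apply: eq_bigr => i _.
    by have [_ ->] := hBE i.
  rewrite integral_prod_indic; last by move=> i; have [] := hBE i.
  apply: eq_bigr => i _; apply: eq_integral => t _.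
  by have [_ ->] := hBE i.
have [ltmn|] := ltnP m n; last first.
  move=> lenm; apply: IHm => // i lemi.
  by have := leq_trans lenm lemi; rewrite leqNgt ltn_ord.
pose i0 := Ordinal ltmn.
(* By [hfin] the other expectations have a real product, as [integral_weighted_comp] requires. *)
pose c := (\prod_(i | i != i0) fine (\int[P]_t (h i (X i t))%:E)%E).
have cE : c%:E = (\prod_(i | i != i0) \int[P]_t (h i (X i t))%:E)%E.
  by rewrite -prodEFin; apply: eq_bigr => i _; rewrite fineK.
pose W t := \prod_(i | i != i0) h i (X i t).
have mX i : measurable_fun setT (X i) by exact: measurable_funP.
rewrite (bigD1 i0)//= -cE muleC.
under eq_integral do rewrite (bigD1 i0)//= mulrC.
apply: (@integral_weighted_comp _ _ _ _ _ P (X i0) W) => //.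
- rewrite /W; under eq_fun do rewrite big_mkcond/=.
  apply: measurable_prod => i _; case: (i != i0) => //.
  exact: measurableT_comp.
- by move=> t; apply: prodr_ge0.
- by apply: prodr_ge0 => i _; apply/fine_ge0/integral_ge0 => t _; rewrite lee_fin.
(* It remains to treat an indicator at [i0]: the family [h'] is arbitrary only below [m], so [IHm]
   applies to it. *)
move=> B mB; pose h' i := if i == i0 then \1_B else h i.
have h'i0 : h' i0 = \1_B by rewrite /h' eqxx.
have h'E i : i != i0 -> h' i = h i by rewrite /h' => /negbTE ->.
have -> : (c%:E = \prod_(i | i != i0) \int[P]_t (h' i (X i t))%:E)%E.
  by rewrite cE; apply: eq_bigr => i ii0; rewrite h'E.
rewrite -h'i0 muleC.
transitivity (\prod_i \int[P]_t (h' i (X i t))%:E)%E; last by rewrite (bigD1 i0).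
rewrite -IHm.
- apply: eq_integral => t _; rewrite [in RHS](bigD1 i0)//= mulrC; congr (_ * _)%:E.
  by apply: eq_bigr => i ii0; rewrite h'E.
- by move=> i; rewrite /h'; case: ifP.
- by move=> i y; rewrite /h'; case: ifP.
- move=> i; rewrite /h'; case: ifP => // _.
  by rewrite integral_indic_comp// fin_num_measure//; exact: measurable_preimage.
- move=> i lemi; have [->|ii0] := eqVneq i i0; first by exists B.
  by rewrite h'E//; apply: hB; rewrite ltn_neqAle lemi andbT eq_sym.
Qed.

Lemma integral_prod_comp (h : 'I_n -> R -> R) :
  (forall i, measurable_fun setT (h i)) -> (forall i y, 0 <= h i y) ->
  (forall i, (\int[P]_t (h i (X i t))%:E)%E \is a fin_num) ->
  (\int[P]_t (\prod_i h i (X i t))%:E = \prod_i \int[P]_t (h i (X i t))%:E)%E.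
Proof.
move=> mh h0 hfin; apply: (integral_prod_comp_upto (m := n)) => // i.
by rewrite leqNgt ltn_ord.
Qed.

End expectation_of_product.

(** * Chernoff bound for independent sums *)

Section independent_sum.
Context d (T : measurableType d) (R : realType) (P : probability T R).
Variables (mu sigma al be : R) (g : R -> R).
Hypothesis mg : measurable_fun setT g.
Hypothesis be0 : 0 <= be.
Hypothesis expg : forall z, expR (g z) <= 1 + al * (z - mu) + be * (z - mu) ^+ 2.

(** Integrate [expg] at [Y]: the linear term has mean zero and the quadratic one gives the
    variance. *)
Lemma integral_expR_comp_le (Y : {RV P >-> R}) :
  (Y : T -> R) \in Lfun P 2%:E -> ('E_P[Y] = mu%:E)%E ->
  ('V_P[Y] = (sigma ^+ 2)%:E)%E ->
  (\int[P]_t (expR (g (Y t)))%:E <= (1 + be * sigma ^+ 2)%:E)%E.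
Proof.
move=> Y2 EY VY.
have Lfun21 f : f \in Lfun P 2%:E -> f \in Lfun P 1.
  exact: (@Lfun_subset12 _ _ _ P (fin_num_measure P _ measurableT)).
have Y1 : (Y : T -> R) \in Lfun P 1 by exact: Lfun21.
have mY : measurable_fun setT Y by exact: measurable_funP.
pose Z := (Y \- cst mu)%R.
have Z2 : Z \in Lfun P 2%:E by rewrite /Z rpredB ?lee1n//= => _; rewrite Lfun_cst.
have Z1 : Z \in Lfun P 1 by exact: Lfun21.
have ZZ1 : (Z * Z)%R \in Lfun P 1 by exact: Lfun2_mul_Lfun1.
have EZ : ('E_P[Z] = 0)%E.
  by rewrite /Z expectationB ?Lfun_cst// EY expectation_cst -EFinB subrr.
have EZZ : ('E_P[(Z * Z)%R] = (sigma ^+ 2)%:E)%E.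
  by rewrite -VY /variance covariance.unlock EY.
apply: (@le_trans _ _ ('E_P[(cst 1 \+ al \o* Z \+ be \o* (Z * Z))%R])%E).
  rewrite unlock; apply: ge0_le_integral => //.
  - by apply/measurable_EFinP; do 2 apply: measurableT_comp => //.
  - apply/measurable_EFinP; rewrite /Z.
    by repeat (apply: measurable_funD => // || apply: measurable_funM => // || apply: measurable_funB => //).
  - move=> t _; rewrite lee_fin (le_trans (expg _))//= expr2.
    by rewrite [al * _]mulrC [be * _]mulrC.
clearbody Z.
rewrite !expectationD ?Lfun_scale ?Lfun_cst ?rpredD ?Lfun_cst ?Lfun_scale//.
rewrite !expectationZl// EZ EZZ expectation_cst mule0 adde0.
by rewrite -EFinM -EFinD.
Qed.

Variables (n : nat) (X : 'I_n -> {RV P >-> R}).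
Hypothesis indepX : mutually_independent X.
Hypothesis X2 : forall i, (X i : T -> R) \in Lfun P 2%:E.
Hypothesis EX : forall i, ('E_P[X i] = mu%:E)%E.
Hypothesis VX : forall i, ('V_P[X i] = (sigma ^+ 2)%:E)%E.

(** Chernoff's bound with parameter 1, the scale being absorbed in [g]. Independence makes the
    moment generating function a product of [n] factors, each at most [1 + u <= expR u] with
    [u = be * sigma ^+ 2]. *)
Lemma independent_sum_tail (a : R) :
  (P [set t | (a <= \sum_i g (X i t))%R] <=
   (expR (n%:R * (be * sigma ^+ 2) - a))%:E)%E.
Proof.
have mX i : measurable_fun setT (X i) by exact: measurable_funP.
pose s t := \sum_i g (X i t).
have ms : measurable_fun setT s.
  by apply: measurable_sum => i; exact: measurableT_comp.
pose S : {RV P >-> R} := HB.pack s (isMeasurableFun.Build _ _ _ _ s ms).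
have := @chernoff _ _ _ P S 1 a ltr01; rewrite mul1r => /le_trans; apply.
rewrite expRD EFinM lee_wpmul2r ?lee_fin ?expR_ge0//.
have le1 i := integral_expR_comp_le (X2 i) (EX i) (VX i).
have ge0 i : (0 <= \int[P]_t (expR (g (X i t)))%:E)%E.
  by apply: integral_ge0 => t _; rewrite lee_fin expR_ge0.
have fin i : (\int[P]_t (expR (g (X i t)))%:E)%E \is a fin_num.
  by rewrite ge0_fin_numE// (le_lt_trans (le1 i))// ltry.
have -> : 'M_P S 1 = (\prod_i \int[P]_t (expR (g (X i t)))%:E)%E.
  rewrite -(integral_prod_comp indepX (h := fun=> expR \o g)).
  - rewrite /mmt_gen_fun unlock; apply: eq_integral => t _ /=.
    by rewrite mulr1 /s expR_sum.
  - by move=> i; exact: measurableT_comp.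
  - by move=> i y; exact: expR_ge0.
  - exact: fin.
under eq_bigr do rewrite -[(\int[P]_t _)%E]fineK//.
rewrite prodEFin lee_fin mulrC expRM_natr.
apply: (@le_trans _ _ (\prod_(i < n) (1 + be * sigma ^+ 2))).
  by apply: ler_prod => i _; rewrite fine_ge0//= -lee_fin fineK.
rewrite prodr_const card_ord.
have b0 : 0 <= be * sigma ^+ 2 by rewrite mulr_ge0 ?sqr_ge0.
apply: lerXn2r; rewrite ?nnegrE ?expR_ge0 ?expR_ge1Dx//.
exact: addr_ge0.
Qed.

End independent_sum.

(** * Order statistics through counting *)

Section order_statistics.
Context (R : realType) (n : nat).
Implicit Types (x : 'I_n -> R) (c : R).

Lemma size_order_stats x : size (order_stats x) = n.
Proof. by rewrite size_sort size_map size_enum_ord. Qed.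

Lemma order_stats_sorted x : sorted <=%O (order_stats x).
Proof. exact/sort_sorted/le_total. Qed.

Lemma sum_order_stats (V : nmodType) (f : R -> V) x :
  \sum_(y <- order_stats x) f y = \sum_i f (x i).
Proof.
rewrite (perm_big [seq x i | i <- enum 'I_n]) ?perm_sort//=.
by rewrite big_map big_enum.
Qed.

Lemma count_order_stats (a : pred R) x :
  count a (order_stats x) = (\sum_i a (x i))%N.
Proof.
by rewrite -sum1_count big_mkcond; exact: (sum_order_stats (fun y => a y : nat)).
Qed.

(** At least [n - k] observations are at most [c], hence so are the entries [0, ..., n - k - 1] of
    the sorted sequence. *)
Lemma order_stats_le x c k j : (\sum_i (c < x i)%R <= k)%N -> (j < n - k)%N ->
  (order_stats x)`_j <= c.
Proof.
rewrite -(count_order_stats (fun y => c < y)) => cnt jnk.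
apply: nth_count_le (order_stats_sorted x) _.
by rewrite count_le_gt size_order_stats; apply: leq_trans jnk (leq_sub2l _ cnt).
Qed.

Lemma order_stats_ge x c k j : (\sum_i (x i < c)%R <= k)%N -> (k <= j < n)%N ->
  c <= (order_stats x)`_j.
Proof.
rewrite -(count_order_stats (fun y => y < c)) => cnt /andP[kj jn].
apply: nth_count_ge (order_stats_sorted x) _.
by rewrite size_order_stats jn andbT; exact: leq_trans kj.
Qed.

(** Turns a ray condition on an order statistic into one on a sum of indicators, whence
    measurability. *)
Lemma lt_order_statsE x c j : (j < n)%N ->
  (c < (order_stats x)`_j) = (\sum_i (x i <= c)%R <= j)%N.
Proof.
move=> jn; rewrite -(count_order_stats (fun y => y <= c)).
apply/idP/idP => [cj|cnt].
  rewrite leqNgt; apply/negP => /(nth_count_le 0 (order_stats_sorted x)).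
  by rewrite leNgt cj.
by apply: nth_count_gt (order_stats_sorted x) _; rewrite size_order_stats cnt.
Qed.

End order_statistics.

(** * Measurability of the trimmed mean *)

Section trimmed_mean_measurable.
Context d (T : measurableType d) (R : realType) (n : nat).
Variable X : 'I_n -> T -> R.
Hypothesis mX : forall i, measurable_fun setT (X i).

Lemma measurable_order_stats j :
  measurable_fun setT (fun t => (order_stats (X ^~ t))`_j).
Proof.
(* Beyond the sample the entry is the default 0, a constant function. *)
have [jn|nj] := ltnP j n; last first.
  under eq_fun do rewrite nth_default ?size_order_stats//.
  exact: measurable_cst.
(* Rays open to the right generate the Borel sets; the preimage of one says that the count [N] is at
   most [j]. *)
move=> _; apply: (measurability _ (RGenOInfty.measurableE R)) => //.
move=> /= _ [_ [c ->] <-]; rewrite setTI.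
pose N t : R := \sum_i (if X i t <= c then 1 else 0).
have mN : measurable_fun setT (fun t => N t <= j%:R).
  apply: measurable_fun_ler => //; apply: measurable_sum => i.
  by apply: measurable_fun_ifT => //; exact: measurable_fun_ler.
have := mN measurableT [set true] I; rewrite setTI.
have NE t : N t = (\sum_i (X i t <= c)%R)%N%:R.
  by rewrite natr_sum; apply: eq_bigr => i _; case: (_ <= _).
congr (measurable _); apply/seteqP; split=> t /=;
  by rewrite in_itv/= andbT lt_order_statsE// NE ler_nat.
Qed.

Lemma measurable_trimmed_mean k :
  measurable_fun setT (fun t => trimmed_mean n k (X ^~ t)).
Proof.
apply: measurable_funM => //; apply: measurable_sum => j.
exact: measurable_order_stats.
Qed.

Lemma measurable_trimmed_mean_dist_gt k (mu c : R) :
  measurable [set t | c < `|trimmed_mean n k (X ^~ t) - mu|].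
Proof.
have mf : measurable_fun setT (fun t => c < `|trimmed_mean n k (X ^~ t) - mu|).
  apply: measurable_fun_ltr => //; apply: measurableT_comp => //.
  by apply: measurable_funB => //; exact: measurable_trimmed_mean.
by have := mf measurableT [set true] I; rewrite setTI.
Qed.

End trimmed_mean_measurable.

(** * Clipping and the deterministic bound *)

Definition clip (R : realType) (M y : R) : R := Num.max (- M) (Num.min M y).

Lemma clip_abs_le (R : realType) (M y : R) : 0 <= M -> `|clip M y| <= M.
Proof.
move=> M0; rewrite ler_norml /clip le_max lexx/= ge_max ge_min lexx/= andbT.
by rewrite (le_trans _ M0)// oppr_le0.
Qed.

Lemma clip_id (R : realType) (M y : R) : - M <= y -> y <= M -> clip M y = y.
Proof. by move=> My yM; rewrite /clip min_r// max_r. Qed.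

(** Oddness turns the lower tail of the clipped sum into the upper tail for the reflected
    deviations. *)
Lemma clipN (R : realType) (M y : R) : 0 <= M -> clip M (- y) = - clip M y.
Proof.
move=> M0; have [yM|My] := leP y (- M).
  by rewrite /clip min_l 1?max_r 1?min_r 1?max_l//; lra.
have [My'|y'M] := leP M y.
  by rewrite /clip min_r 1?max_l 1?min_l 1?max_r//; lra.
by rewrite !clip_id//; lra.
Qed.

(** The sorted clipped sum splits into the [k] lowest terms, the kept ones and the [k] highest. The
    kept block is bounded by the whole sum plus the outer blocks, of size at most [k * M] each. *)
Lemma trimmed_mean_dist (R : realType) (n k : nat) (x : 'I_n -> R) (mu M D : R) :
  0 <= M -> (2 * k < n)%N ->
  (\sum_i (mu + M < x i)%R <= k)%N -> (\sum_i (x i < mu - M)%R <= k)%N ->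
  `|\sum_i clip M (x i - mu)| <= D ->
  `|trimmed_mean n k x - mu| <= (D + 2 * k%:R * M) / (n - 2 * k)%:R.
Proof.
move=> M0 kn hi lo clipD; pose s := order_stats x.
have nk0 : 0 < (n - 2 * k)%:R :> R by rewrite ltr0n subn_gt0.
pose F j := clip M (s`_j - mu).
have FM j : `|F j| <= M by exact: clip_abs_le.
have sumF : \sum_i clip M (x i - mu) = \sum_(0 <= j < k) F j +
    \sum_(k <= j < n - k) F j + \sum_(n - k <= j < n) F j.
  rewrite -(sum_order_stats (fun y => clip M (y - mu))) (big_nth 0).
  by rewrite size_order_stats -!big_cat_nat//=; lia.
(* The two counts put each kept order statistic within [M] of [mu], where clipping is the
   identity. *)
have midF : \sum_(k <= j < n - k) F j =
    (trimmed_mean n k x - mu) * (n - 2 * k)%:R.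
  rewrite mulrBl divfK ?gt_eqF// (_ : (n - 2 * k)%N = (n - k - k)%N); last by lia.
  rewrite mulr_natr -sumr_const_nat -sumrB; apply: eq_big_nat => j /andP[kj jnk].
  rewrite /F clip_id// -/s.
    by rewrite lerBrDl; apply: order_stats_ge lo _; lia.
  by rewrite lerBlDl; exact: order_stats_le hi _.
have tailF a b : `|\sum_(a <= j < b) F j| <= (b - a)%:R * M.
  rewrite (le_trans (ler_norm_sum _ _ _))//.
  rewrite (le_trans (ler_sum _ (fun j _ => FM j)))//.
  by rewrite sumr_const_nat mulr_natl.
rewrite ler_pdivlMr// -[X in _ * X]gtr0_norm// -normrM -midF.
have -> : \sum_(k <= j < n - k) F j = \sum_i clip M (x i - mu)
    - \sum_(0 <= j < k) F j - \sum_(n - k <= j < n) F j by rewrite sumF; ring.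
have := tailF 0%N k; rewrite subn0 => h1.
have := tailF (n - k)%N n; rewrite (_ : (n - (n - k))%N = k); last by lia.
move=> h2; apply: le_trans (ler_normB _ _) _.
have := ler_normB (\sum_i clip M (x i - mu)) (\sum_(0 <= j < k) F j).
by move=> h3; lra.
Qed.

(** * Quadratic bounds for the exponential *)

Section exponential_bounds.
Context (R : realType).
Implicit Types v M z mu : R.

Lemma expR_le_inv v : v < 1 -> expR v <= (1 - v)^-1.
Proof.
move=> v1; rewrite -[v in leLHS]opprK expRN lef_pV2 ?posrE ?expR_gt0 ?subr_gt0//.
exact: expR_ge1Dx.
Qed.

(** Square the bound [expR u <= (1 - u)^-1] at [u = v / 2]; a polynomial inequality remains. *)
Lemma expR_le_quadratic v : v <= 1 -> expR v <= 1 + v + 2 * v ^+ 2.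
Proof.
move=> v1; have v2 : 0 < 1 - v / 2 by lra.
have -> : expR v = expR (v / 2) ^+ 2 by rewrite -expRM_natl; congr expR; field.
have h : expR (v / 2) <= (1 - v / 2)^-1 by apply: expR_le_inv; lra.
apply: (@le_trans _ _ ((1 - v / 2)^-1 ^+ 2)).
  by rewrite lerXn2r ?nnegrE ?expR_ge0// invr_ge0 ltW.
rewrite exprVn -div1r ler_pdivrMr ?exprn_gt0//.
rewrite -subr_ge0.
have -> : (1 + v + 2 * v ^+ 2) * (1 - v / 2) ^+ 2 - 1 =
   v ^+ 2 * ((1 - v) * (5 / 2 - v)) / 2 by field.
by rewrite divr_ge0// mulr_ge0 ?sqr_ge0// mulr_ge0//; lra.
Qed.

Lemma expR2_le9 : expR 2 <= 9 :> R.
Proof.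
(* The inverse bound at [1 / 8] followed by four squarings, rounded up to rationals. Starting from
   [1 / 4] would give [(4 / 3) ^+ 8], which exceeds 9. *)
have -> : expR 2 = (((expR (8^-1) ^+ 2) ^+ 2) ^+ 2) ^+ 2 :> R.
  by rewrite -!exprM -expRM_natl; congr expR; field.
have h : expR (8^-1) <= 8 / 7 :> R.
  by rewrite (_ : 8 / 7 = (1 - 8^-1)^-1); [apply: expR_le_inv; lra|field].
have le_sqr (a b c : R) : 0 <= a -> a <= b -> b ^+ 2 <= c -> a ^+ 2 <= c.
  by move=> a0 ab; apply: le_trans; rewrite lerXn2r ?nnegrE// (le_trans a0).
have h1 : expR (8^-1) ^+ 2 <= 64 / 49 :> R.
  by apply: (le_sqr _ (8 / 7)); [exact: expR_ge0|exact: h|lra].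
have h2 : (expR (8^-1) ^+ 2) ^+ 2 <= 171 / 100 :> R.
  by apply: (le_sqr _ (64 / 49)); [exact: sqr_ge0|exact: h1|lra].
have h3 : ((expR (8^-1) ^+ 2) ^+ 2) ^+ 2 <= 293 / 100 :> R.
  by apply: (le_sqr _ (171 / 100)); [exact: sqr_ge0|exact: h2|lra].
by apply: (le_sqr _ (293 / 100)); [exact: sqr_ge0|exact: h3|lra].
Qed.

(** Put [u = v / M]. For [u > 1] the left side is [expR 1 <= 4], below [1 + u + 2 * u ^+ 2]; for
    [u < - 1] it is at most 1 while [u + 2 * u ^+ 2 > 0]; in between the quadratic bound applies
    directly. *)
Lemma expR_clip_le M v : 0 < M ->
  expR (clip M v / M) <= 1 + M^-1 * v + 2 * M ^- 2 * v ^+ 2.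
Proof.
move=> M0; have -> : 1 + M^-1 * v + 2 * M ^- 2 * v ^+ 2 =
    1 + v / M + 2 * (v / M) ^+ 2 by field; rewrite gt_eqF.
have [Mv|vM] := ltP M v.
  have -> : clip M v = M by rewrite /clip min_l ?max_r ?ltW//; lra.
  have : 1 < v / M by rewrite ltr_pdivlMr// mul1r.
  rewrite divff ?gt_eqF// => ?; have := @expR_le_quadratic 1 (lexx _).
  by nra.
have [vNM|NMv] := ltP v (- M).
  have -> : clip M v = - M by rewrite /clip min_r// max_l// ltW.
  have : v / M < - 1 by rewrite ltr_pdivrMr// mulN1r.
  rewrite mulNr divff ?gt_eqF// => ?.
  have : expR (- 1) <= 1 :> R by rewrite expR_le1; lra.
  by nra.
rewrite clip_id//; apply: expR_le_quadratic.
by rewrite ler_pdivrMr// mul1r.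
Qed.

(** If [b] holds, then [v ^+ 2 / M ^+ 2 >= 1] and [expR 2 <= 1 + 8]. The zero linear term matches
    the shape of [expg]. *)
Lemma expR_indic_le M v (b : bool) : 0 < M -> (b -> M <= `|v|) ->
  expR (2 * b%:R) <= 1 + 0 * v + 8 * M ^- 2 * v ^+ 2.
Proof.
move=> M0; rewrite mul0r addr0; case: b => [/(_ isT) Mv|_]; last first.
  by rewrite mulr0 expR0 lerDl mulr_ge0 ?sqr_ge0// mulr_ge0// invr_ge0 sqr_ge0.
rewrite mulr1 (le_trans expR2_le9)//.
have : 1 <= M ^- 2 * v ^+ 2.
  rewrite mulrC ler_pdivlMr ?exprn_gt0// mul1r -[v ^+ 2]real_normK ?num_real//.
  by rewrite lerXn2r ?nnegrE// ltW.
by lra.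
Qed.

End exponential_bounds.

(** * Tail bounds for the trimmed mean *)

Section trimmed_mean_tail.
Context (R : realType) d (T : measurableType d) (P : probability T R).
Variables (n : nat) (X : 'I_n -> {RV P >-> R}) (mu sigma : R) (k : nat).
Hypothesis indepX : mutually_independent X.
Hypothesis X2 : forall i, (X i : T -> R) \in Lfun P 2%:E.
Hypothesis EX : forall i, ('E_P[X i] = mu%:E)%E.
Hypothesis VX : forall i, ('V_P[X i] = (sigma ^+ 2)%:E)%E.
Hypothesis k2n : (2 * k < n)%N.

Let mX i : measurable_fun setT (X i). Proof. exact: measurable_funP. Qed.

Let dist t : R := `|trimmed_mean n k (fun i => X i t) - mu|.

Let measurable_dist_gt (c : R) : measurable [set t | c < dist t].
Proof. exact: measurable_trimmed_mean_dist_gt mX k mu c. Qed.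

Let measurable_sum_ge (g : R -> R) (a : R) : measurable_fun setT g ->
  measurable [set t | a <= \sum_i g (X i t)].
Proof.
move=> mg.
have mf : measurable_fun setT (fun t => a <= \sum_i g (X i t)).
  apply: measurable_fun_ler => //; apply: measurable_sum => i.
  exact: measurableT_comp.
by have := mf measurableT [set true] I; rewrite setTI.
Qed.

Lemma trimmed_mean_tail (M : R) : 0 < M -> 9 * n%:R * sigma ^+ 2 <= k%:R * M ^+ 2 ->
  (P [set t | (29 / 9 * k%:R * M / (n - 2 * k)%:R < dist t)%R] <=
   (4 * expR (- k%:R))%:E)%E.
Proof.
move=> M0 nk.
(* The factor 2 on the indicators and [1 / M] on the clipped deviations act as the Chernoff
   parameters. *)
pose hi (z : R) : R := 2 * (mu + M < z)%R%:R.
pose lo (z : R) : R := 2 * (z < mu - M)%R%:R.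
pose up z := clip M (z - mu) / M.
pose dn z := clip M (mu - z) / M.
have bool_measurable (b : R -> bool) : measurable_fun setT b ->
    measurable_fun setT (fun z => 2 * (b z)%:R : R).
  move=> mb; apply: measurable_funM => //.
  rewrite (_ : (fun z => (b z)%:R) = (fun z => if b z then 1 else 0)).
    exact: measurable_fun_ifT.
  by apply/funext => z; case: (b z).
have mhi : measurable_fun setT hi.
  by apply: bool_measurable; exact: measurable_fun_ltr.
have mlo : measurable_fun setT lo.
  by apply: bool_measurable; exact: measurable_fun_ltr.
have mup : measurable_fun setT up.
  apply: measurable_funM => //; apply: measurable_maxr => //.
  by apply: measurable_minr => //; exact: measurable_funB.
have mdn : measurable_fun setT dn.
  apply: measurable_funM => //; apply: measurable_maxr => //.
  by apply: measurable_minr => //; exact: measurable_funB.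
have M20 : 0 <= M ^- 2 by rewrite invr_ge0 sqr_ge0.
have sM : n%:R * (M ^- 2 * sigma ^+ 2) <= k%:R / 9.
  rewrite mulrCA mulrC ler_pdivrMr ?exprn_gt0//; lra.
(* Since [n * sigma ^+ 2 / M ^+ 2 <= k / 9], the Chernoff exponent is at most [be / 9 * k - a]. *)
have tail (g : R -> R) (al be a : R) : measurable_fun setT g -> 0 <= be ->
    (forall z, expR (g z) <= 1 + al * (z - mu) + be * M ^- 2 * (z - mu) ^+ 2) ->
    be / 9 * k%:R - a <= - k%:R ->
    (P [set t | (a <= \sum_i g (X i t))%R] <= (expR (- k%:R))%:E)%E.
  move=> mg be0 expg abe.
  have bM0 : 0 <= be * M ^- 2 by rewrite mulr_ge0.
  apply: le_trans (independent_sum_tail mg bM0 expg indepX X2 EX VX a) _.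
  rewrite lee_fin ler_expR; apply: le_trans abe; rewrite lerB//.
  have := ler_wpM2l be0 sM; lra.
have k0 : 0 <= k%:R :> R by [].
(* More than [k] hits means at least [k + 1], each weighted by 2; the exponent is
   [8 / 9 * k - 2 * (k + 1) <= - k]. *)
have tail_hi : (P [set t | (2 * k.+1%:R <= \sum_i hi (X i t))%R] <= (expR (- k%:R))%:E)%E.
  apply: (tail hi 0 8) => //; last by rewrite -natr1; lra.
  move=> z; apply: expR_indic_le => // Mz; rewrite ler_normr; lra.
have tail_lo : (P [set t | (2 * k.+1%:R <= \sum_i lo (X i t))%R] <= (expR (- k%:R))%:E)%E.
  apply: (tail lo 0 8) => //; last by rewrite -natr1; lra.
  move=> z; apply: expR_indic_le => // Mz; rewrite ler_normr; lra.
(* The level [11 / 9] makes the exponent exactly [- k], as [2 / 9 - 11 / 9 = - 1]. *)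
have tail_up : (P [set t | (11 / 9 * k%:R <= \sum_i up (X i t))%R] <= (expR (- k%:R))%:E)%E.
  apply: (tail up M^-1 2) => //; last by lra.
  by move=> z; exact: expR_clip_le.
have tail_dn : (P [set t | (11 / 9 * k%:R <= \sum_i dn (X i t))%R] <= (expR (- k%:R))%:E)%E.
  apply: (tail dn (- M^-1) 2) => //; last by lra.
  by move=> z; rewrite -[z - mu]opprB mulrNN sqrrN; exact: expR_clip_le.
pose bad := [set t | 2 * k.+1%:R <= \sum_i hi (X i t)] `|`
  [set t | 2 * k.+1%:R <= \sum_i lo (X i t)] `|`
  ([set t | 11 / 9 * k%:R <= \sum_i up (X i t)] `|`
  [set t | 11 / 9 * k%:R <= \sum_i dn (X i t)]).
apply: (@le_trans _ _ (P bad)).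
  apply: le_measure; rewrite ?inE.
  - exact: measurable_dist_gt.
  - by apply: measurableU; apply: measurableU; exact: measurable_sum_ge.
  move=> t /= tdist; apply: contrapT => /not_orP[/not_orP[/= hit lot] /not_orP[/= upt dnt]].
  have count_le (b : R -> bool) :
      ~ 2 * k.+1%:R <= \sum_i 2 * (b (X i t))%:R :> R -> (\sum_i b (X i t) <= k)%N.
    move=> h; rewrite -ltnS -(ltr_nat R) natr_sum ltNge; apply/negP => h'; apply: h.
    by rewrite -mulr_sumr; lra.
  have {}hit := count_le (fun z => mu + M < z) hit.
  have {}lot := count_le (fun z => z < mu - M) lot.
  move: tdist; apply/negP; rewrite -leNgt.
  have clip0 : `|\sum_i clip M (X i t - mu)| <= 11 / 9 * k%:R * M.
    have -> : \sum_i clip M (X i t - mu) = (\sum_i up (X i t)) * M.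
      by rewrite mulr_suml; apply: eq_bigr => i _; rewrite /up divfK// gt_eqF.
    rewrite normrM (gtr0_norm M0) ler_pM2r//.
    have dnE : \sum_i dn (X i t) = - \sum_i up (X i t).
      rewrite -sumrN; apply: eq_bigr => i _; rewrite /dn /up -mulNr; congr (_ / _).
      by rewrite -[mu - _]opprB clipN ?ltW.
    move: upt dnt => /negP; rewrite -ltNge => upt /negP; rewrite -ltNge dnE => dnt.
    by rewrite ler_norml; lra.
  (* The constant is [11 / 9 + 2 = 29 / 9]. *)
  have := trimmed_mean_dist (ltW M0) k2n hit lot clip0.
  by rewrite -mulrDl; congr (_ <= _ / _); lra.
have mge g a := @measurable_sum_ge g a.
rewrite (_ : 4 * expR (- k%:R) = (expR (- k%:R) + expR (- k%:R)) + (expR (- k%:R) + expR (- k%:R))); last by ring.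
rewrite EFinD; apply: le_trans (measureU2 _ _ _) _ => //; try by apply: measurableU; exact: mge.
by apply: leeD; rewrite EFinD; apply: le_trans (measureU2 _ _ _) _ => //; try (exact: mge); apply: leeD.
Qed.

(** With [sigma = 0] every [M > 0] is admissible. The event is the increasing union of the events
    [A m], and continuity from below preserves the bound. *)
Lemma degenerate_trimmed_mean_tail : sigma = 0 -> (0 < k)%N ->
  (P [set t | (0 < dist t)%R] <= (4 * expR (- k%:R))%:E)%E.
Proof.
move=> sigma0 k0; have k0R : 0 < k%:R :> R by rewrite ltr0n.
have nk0 : 0 < (n - 2 * k)%:R :> R by rewrite ltr0n subn_gt0.
pose A (m : nat) := [set t | m.+1%:R^-1 < dist t].
have -> : [set t | 0 < dist t] = \bigcup_m A m.
  apply/seteqP; split=> t /=; last first.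
    by move=> [m _]; apply: lt_trans; rewrite invr_gt0.
  move=> /ltr_add_invr[m]; rewrite add0r => h; by exists m.
have mA m : measurable (A m) by exact: measurable_dist_gt.
have ndA : nondecreasing_seq A.
  move=> p q pq; apply/subsetPset => t /=; apply: le_lt_trans.
  by rewrite lef_pV2 ?posrE// ler_nat ltnS.
have cA := nondecreasing_cvg_mu (mu := P) mA (bigcupT_measurable _ mA) ndA.
rewrite -(cvg_lim _ cA)//; apply: lime_le; first by apply/cvg_ex; eexists; exact: cA.
apply: nearW => m /=.
(* Chosen so that the threshold of [trimmed_mean_tail] is [1 / (m + 1)]. *)
pose M : R := m.+1%:R^-1 * (9 * (n - 2 * k)%:R / (29 * k%:R)).
have M0 : 0 < M by rewrite mulr_gt0 ?invr_gt0// divr_gt0 ?mulr_gt0.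
have ME : 29 / 9 * k%:R * M / (n - 2 * k)%:R = m.+1%:R^-1.
  by rewrite /M; field; rewrite !gt_eqF.
rewrite /A -ME; apply: trimmed_mean_tail => //.
by rewrite sigma0 expr0n mulr0 mulr_ge0// sqr_ge0.
Qed.

Lemma nondegenerate_trimmed_mean_tail : 0 < sigma -> (0 < k)%N ->
  (P [set t | (29 / 3 * Num.sqrt k%:R * Num.sqrt n%:R * sigma / (n - 2 * k)%:R
     < dist t)%R] <= (4 * expR (- k%:R))%:E)%E.
Proof.
move=> sigma0 k0; have k0R : 0 < k%:R :> R by rewrite ltr0n.
have n0R : 0 < n%:R :> R by rewrite ltr0n; exact: leq_trans k2n.
have nk0 : 0 < (n - 2 * k)%:R :> R by rewrite ltr0n subn_gt0.
set q := Num.sqrt k%:R; set w := Num.sqrt n%:R.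
have q0 : 0 < q by rewrite sqrtr_gt0.
have w0 : 0 < w by rewrite sqrtr_gt0.
have q2 : k%:R = q ^+ 2 by rewrite sqr_sqrtr.
have w2 : n%:R = w ^+ 2 by rewrite sqr_sqrtr.
(* The least [M] that [trimmed_mean_tail] allows: its condition becomes an equality. *)
pose M := 3 * sigma * w / q.
have M0 : 0 < M by rewrite divr_gt0 ?mulr_gt0.
have -> : 29 / 3 * q * w * sigma / (n - 2 * k)%:R =
    29 / 9 * k%:R * M / (n - 2 * k)%:R.
  by rewrite q2 /M; field; rewrite !gt_eqF.
apply: trimmed_mean_tail => //.
rewrite le_eqVlt; apply/orP; left; apply/eqP.
by rewrite w2 q2 /M; field; rewrite gt_eqF.
Qed.

End trimmed_mean_tail.


(** * Comparison of the thresholds *)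

(** The bound on [k] comes from the ceiling, that on [n] from the range of [x], as
    [3 + 2 * Num.sqrt 2] is the square of [Num.sqrt 2 + 1]. The lower bound [7 / 5] for [Num.sqrt 2]
    is precise enough throughout. *)
Lemma trimmed_mean_threshold_le (R : realType) (n k : nat) (sigma x : R) :
  0 <= sigma -> 0 < x -> k%:R <= x ^+ 2 / 2 + 1 ->
  (x ^+ 2 + 2) * (3 + 2 * Num.sqrt 2) <= n%:R ->
  (2 * k < n)%N /\
  29 / 3 * Num.sqrt k%:R * Num.sqrt n%:R * sigma / (n - 2 * k)%:R <=
  (3 * Num.sqrt 2 + 8 + (4 + 4 * Num.sqrt 2) * x) * sigma / Num.sqrt n%:R.
Proof.
move=> sigma0 x0 kx nx; set r : R := Num.sqrt 2 in nx *.
have r0 : 0 <= r by exact: sqrtr_ge0.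
have r2 : r ^+ 2 = 2 by rewrite sqr_sqrtr.
have rlo : 7 / 5 <= r.
  by rewrite -(@ler_pXn2r _ 2) ?nnegrE ?r2//; lra.
have k0 : 0 <= k%:R :> R by [].
have x20 : 0 <= x ^+ 2 by exact: sqr_ge0.
have {}nx : (x ^+ 2 + 2) * (29 / 5) <= n%:R.
  by apply: le_trans nx; rewrite ler_wpM2l//; lra.
have n0R : 0 < n%:R :> R by lra.
(* Here [2 * k <= x ^+ 2 + 2 <= 5 / 29 * n <= n / 5]. *)
have nk : 4 / 5 * n%:R <= n%:R - 2 * k%:R :> R by lra.
have k2n : (2 * k < n)%N by rewrite -(ltr_nat R) natrM; lra.
split=> //.
have -> : (n - 2 * k)%:R = n%:R - 2 * k%:R :> R.
  by rewrite (natrB _ (ltnW k2n)) natrM.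
set w := Num.sqrt n%:R; set q := Num.sqrt k%:R.
have w0 : 0 < w by rewrite sqrtr_gt0.
have w2 : n%:R = w ^+ 2 by rewrite sqr_sqrtr ?ltW.
have q0 : 0 <= q by exact: sqrtr_ge0.
have q2 : q ^+ 2 = k%:R by rewrite sqr_sqrtr.
(* The slope [5 / 7] is just above the inverse of [Num.sqrt 2]: [25 / 49 >= 1 / 2]. *)
have qx : q <= 1 + 5 / 7 * x.
  rewrite -(@ler_pXn2r _ 2) ?nnegrE//; last by lra.
  rewrite q2.
  have -> : (1 + 5 / 7 * x) ^+ 2 = 1 + 10 / 7 * x + 25 / 49 * x ^+ 2 by field.
  by lra.
rewrite ler_pdivrMr; last by lra.
set C := 3 * r + 8 + (4 + 4 * r) * x.
(* Then [4 / 5 * C >= 244 / 25 + 192 / 25 * x], which exceeds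
   [29 / 3 + 145 / 21 * x >= 29 / 3 * q]. *)
have C0 : 61 / 5 + 48 / 5 * x <= C.
  have : 48 / 5 * x <= (4 + 4 * r) * x by rewrite ler_pM2r//; lra.
  by rewrite /C; lra.
have C1 : 0 <= C by apply: le_trans C0; lra.
apply: (@le_trans _ _ (C * sigma / w * (4 / 5 * n%:R))); last first.
  by apply: ler_wpM2l => //; apply: divr_ge0; [exact: mulr_ge0|exact: ltW].
have -> : C * sigma / w * (4 / 5 * n%:R) = (4 / 5 * C) * (w * sigma).
  by rewrite w2; field; rewrite gt_eqF.
have -> : 29 / 3 * q * w * sigma = (29 / 3 * q) * (w * sigma) by rewrite mulrA.
apply: ler_wpM2r; first by rewrite mulr_ge0// ltW.
by lra.
Qed.

(** * The trimming level given by the ceiling *)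

Unset Implicit Arguments.
Theorem theorem1p1 (R : realType) (d : measure_display) (T : measurableType d)
  (P : probability T R) (n : nat) (X : 'I_n -> {RV P >-> R})
  (mu sigma x : R) :
  mutually_independent X ->
  identically_distributed X ->
  (forall i, (X i : T -> R) \in Lfun P 2%:E) ->
  (forall i, ('E_P[X i] = mu%:E)%E) ->
  0 <= sigma ->
  (forall i, ('V_P[X i] = (sigma ^+ 2)%:E)%E) ->
  0 < x ->
  x <= Num.sqrt (n%:R / (Num.sqrt 2 + 1) ^+ 2 - 2) ->
  let k := `|Num.ceil (x ^+ 2 / 2)|%N in
  (P [set t | ((3 * Num.sqrt 2 + 8 + (4 + 4 * Num.sqrt 2) * x) * sigma
                   / Num.sqrt n%:R
                 < `|trimmed_mean n k (fun i => X i t) - mu|)%R ]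
   <= (4 * expR (- (x ^+ 2 / 2)))%:E)%E.
Proof.
move=> indepX _ X2 EX sigma0 VX x0 xn; cbv zeta.
set k := `|Num.ceil (x ^+ 2 / 2)|%N.
have x20 : 0 < x ^+ 2 by rewrite exprn_gt0.
have ceil0 : (0 < Num.ceil (x ^+ 2 / 2))%R.
  by rewrite ceil_gt0 divr_gt0.
have kE : k%:R = (Num.ceil (x ^+ 2 / 2))%:~R :> R.
  by rewrite -[in RHS](gtz0_abs ceil0).
have k0 : (0 < k)%N by rewrite absz_gt0 gt_eqF.
have xk : x ^+ 2 / 2 <= k%:R by rewrite kE; exact: ceil_ge.
have kx : k%:R <= x ^+ 2 / 2 + 1.
  by have := ceilB1_lt (x ^+ 2 / 2); rewrite rmorphB/= -kE; lra.
have r2 : Num.sqrt 2 ^+ 2 = 2 :> R by rewrite sqr_sqrtr.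
have r0 : 0 <= Num.sqrt 2 :> R by exact: sqrtr_ge0.
have nx : (x ^+ 2 + 2) * (3 + 2 * Num.sqrt 2) <= n%:R.
  (* [Num.sqrt] vanishes on negative numbers; being at least [x > 0] here, it has a positive
     radicand, so squaring recovers it. *)
  have s0 : 0 < Num.sqrt (n%:R / (Num.sqrt 2 + 1) ^+ 2 - 2) :> R.
    exact: lt_le_trans xn.
  have : x ^+ 2 <= n%:R / (Num.sqrt 2 + 1) ^+ 2 - 2.
    rewrite -[leRHS]sqr_sqrtr; last by rewrite ltW// -sqrtr_gt0.
    by rewrite lerXn2r ?nnegrE// ltW.
  rewrite lerBrDr ler_pdivlMr; last by rewrite exprn_gt0//; lra.
  by congr (_ * _ <= _); rewrite sqrrD r2; ring.
have [k2n thr] := trimmed_mean_threshold_le sigma0 x0 kx nx.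
have kxe : (4 * expR (- k%:R) <= 4 * expR (- (x ^+ 2 / 2)) :> R)%R.
  by rewrite ler_pM2l// ler_expR lerN2.
apply: (@le_trans _ _ (4 * expR (- k%:R))%:E); last by rewrite lee_fin.
move: sigma0; rewrite le_eqVlt => /predU1P[sigma0|sigma0].
  (* For [sigma = 0] the stated threshold is 0. *)
  have := degenerate_trimmed_mean_tail indepX X2 EX VX k2n (esym sigma0) k0.
  by rewrite -sigma0 mulr0 mul0r.
apply: le_trans (nondegenerate_trimmed_mean_tail indepX X2 EX VX k2n sigma0 k0).
have mdist (c : R) : measurable [set t | c < `|trimmed_mean n k (fun i => X i t) - mu|].
  by apply: measurable_trimmed_mean_dist_gt => i; exact: measurable_funP.
apply: le_measure; rewrite ?inE; [exact: mdist|exact: mdist|].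
by move=> t /=; exact: le_lt_trans.
Qed.
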